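(* Let $I\subset\mathbb{R}$ be an open interval and let $\alpha:I\to\mathbf{E}_1^3$ be a unit speed spacelike curve. (1) Suppose the normal vector $\mathbf{N}(s)$ of $\alpha$ is spacelike for all $s\in I$, the curvature $\kappa$ and torsion $\tau$ vanish nowhere on $I$, and $\tau^2-\kappa^2$ vanishes nowhere on $I$. Then $\alpha$ is a slant helix if and only if one of the two functions $$\frac{\kappa^2}{(\tau^2-\kappa^2)^{3/2}}\Big(\frac{\tau}{\kappa}\Big)'\qquad\text{or}\qquad \frac{\kappa^2}{(\kappa^2-\tau^2)^{3/2}}\Big(\frac{\tau}{\kappa}\Big)'$$ is constant on $I$ (the first function is the one that is defined when $\tau^2>\kappa^2$ on $I$, the second when $\tau^2<\kappa^2$ on $I$). (2) Suppose the normal vector $\mathbf{N}(s)$ of $\alpha$ is timelike for all $s\in I$, and the curvature $\kappa$ and torsion $\tau$ vanish nowhere on $I$. Then $\alpha$ is a slant helix if and only if the function $$\frac{\kappa^2}{(\tau^2+\kappa^2)^{3/2}}\Big(\frac{\tau}{\kappa}\Big)'$$ is constant on $I$. (3) If the normal vector $\mathbf{N}(s)$ of $\alpha$ is lightlike for all $s\in I$ and the torsion $\tau$ vanishes nowhere on $I$, then $\alpha$ is a slant helix.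
   Context: Minkowski 3-space $\mathbf{E}_1^3$ is $\mathbb{R}^3$ with the metric $\langle\,,\rangle=dx_1^2+dx_2^2-dx_3^2$. A vector $v$ is spacelike if $\langle v,v\rangle>0$ or $v=0$, timelike if $\langle v,v\rangle<0$, lightlike if $\langle v,v\rangle=0$ and $v\ne0$; $\|v\|=\sqrt{|\langle v,v\rangle|}$. The vector product is defined by $\langle u\times v,w\rangle=\det(u,v,w)$ for all $w$. Curves are smooth and regular. A curve is spacelike if all its velocity vectors are spacelike; it is unit speed if $\|\alpha'(s)\|=1$ for all $s$. Frenet frame of a unit speed spacelike curve, with $\mathbf{T}=\alpha'$ and $\alpha''$ nowhere zero: (i) If $\alpha''$ is everywhere spacelike or everywhere timelike, then $\mathbf{N}=\alpha''/\|\alpha''\|$, $\mathbf{B}=\mathbf{T}\times\mathbf{N}$, and the curvature $\kappa$ and torsion $\tau$ are determined by the Frenet equations: if $\mathbf{N}$ is spacelike, $$\mathbf{T}'=\kappa\mathbf{N},\quad \mathbf{N}'=-\kappa\mathbf{T}+\tau\mathbf{B},\quad \mathbf{B}'=\tau\mathbf{N};$$ if $\mathbf{N}$ is timelike, $$\mathbf{T}'=\kappa\mathbf{N},\quad \mathbf{N}'=\kappa\mathbf{T}+\tau\mathbf{B},\quad \mathbf{B}'=\tau\mathbf{N}.$$ (ii) If $\alpha''$ is everywhere lightlike, then $\mathbf{N}=\mathbf{T}'$, $\mathbf{B}(s)$ is the unique lightlike vector orthogonal to $\mathbf{T}(s)$ with $\langle\mathbf{N}(s),\mathbf{B}(s)\rangle=1$,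 and the torsion $\tau$ is determined by $$\mathbf{T}'=\mathbf{N},\quad \mathbf{N}'=\tau\mathbf{N},\quad \mathbf{B}'=-\mathbf{T}-\tau\mathbf{B}.$$ A unit speed curve $\alpha$ is a slant helix if there exists a constant nonzero vector $U\in\mathbf{E}_1^3$ such that the function $s\mapsto\langle\mathbf{N}(s),U\rangle$ is constant on $I$. A prime denotes $d/ds$. *)

(* Defs.v *)
From HB Require Import structures.
From mathcomp Require Import all_boot all_order all_algebra.
From mathcomp Require Import ring.
From mathcomp Require Import all_classical all_reals all_analysis.

Set Implicit Arguments.
Unset Strict Implicit.
Unset Printing Implicit Defensive.

Import Order.TTheory GRing.Theory Num.Theory.
Import numFieldNormedType.Exports.
Local Open Scope ring_scope.
Local Open Scope classical_set_scope.

Definition mink (R : realType) (u v : 'rV[R]_3) : R :=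
  u 0 0 * v 0 0 + u 0 1 * v 0 1 - u 0 2%:R * v 0 2%:R.

Definition spacelike (R : realType) (v : 'rV[R]_3) : Prop :=
  0 < mink v v \/ v = 0.

Definition timelike (R : realType) (v : 'rV[R]_3) : Prop := mink v v < 0.

Definition lightlike (R : realType) (v : 'rV[R]_3) : Prop :=
  mink v v = 0 /\ v <> 0.

Definition mink_norm (R : realType) (v : 'rV[R]_3) : R :=
  Num.sqrt `|mink v v|.

Definition det3 (R : realType) (u v w : 'rV[R]_3) : R :=
  \det (\matrix_(i < 3) [:: u; v; w]`_i).

(* The sign on the last coordinate is what raising the index with
   dx_1^2 + dx_2^2 - dx_3^2 produces; [mink_cross] below is the defining
   property of the vector product. *)
Definition cross (R : realType) (u v : 'rV[R]_3) : 'rV[R]_3 :=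
  \row_(i < 3) ((if i == 2%:R then -1 else 1) * det3 u v (delta_mx 0 i)).

Lemma mink_cross (R : realType) (u v w : 'rV[R]_3) :
  mink (cross u v) w = det3 u v w.
Proof.
have [f entryE] : exists f : 'rV[R]_3 -> nat -> R,
    forall (p : 'rV[R]_3) j, p 0 j = f p (val j).
  by exists (fun p k => p 0 (inord k)) => p j; rewrite inord_val.
have detE (x y z : 'rV[R]_3) : det3 x y z =
    x 0 0 * (y 0 1 * z 0 2%:R - y 0 2%:R * z 0 1)
  - x 0 1 * (y 0 0 * z 0 2%:R - y 0 2%:R * z 0 0)
  + x 0 2%:R * (y 0 0 * z 0 1 - y 0 1 * z 0 0).
  rewrite /det3 (expand_det_row _ 0) !big_ord_recl big_ord0 /cofactor.
  rewrite !(expand_det_row _ 0) !big_ord_recl !big_ord0 /cofactor !det_mx11.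
  rewrite !mxE /= !entryE /= /bump /=.
  by ring.
by rewrite /mink !mxE !detE !mxE /=; ring.
Qed.

(* Curves are total functions on [R] used only on the open set [I], so that
   derivatives at points of [I] do not depend on the values outside [I]. *)
Definition smooth_on (R : realType) (I : set R) (a : R -> 'rV[R]_3) : Prop :=
  forall (n : nat) (s : R), I s -> derivable (a^`(n)) s 1.

Definition tangent (R : realType) (a : R -> 'rV[R]_3) : R -> 'rV[R]_3 := a^`().

Definition regular_curve (R : realType) (I : set R) (a : R -> 'rV[R]_3) : Prop :=
  smooth_on I a /\ forall s, I s -> tangent a s <> 0.

Definition spacelike_curve (R : realType) (I : set R) (a : R -> 'rV[R]_3) : Prop :=
  regular_curve I a /\ forall s, I s -> spacelike (tangent a s).

Definition unit_speed (R : realType) (I : set R) (a : R -> 'rV[R]_3) : Prop :=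
  forall s, I s -> mink_norm (tangent a s) = 1.

(* The first branch is the lightlike case, where the normal is not rescaled;
   it also returns 0 at the points where a'' vanishes. *)
Definition normal (R : realType) (a : R -> 'rV[R]_3) (s : R) : 'rV[R]_3 :=
  let a2 := (a^`(2)) s in
  if mink a2 a2 == 0 then a2 else (mink_norm a2)^-1 *: a2.

Definition binormal (R : realType) (a : R -> 'rV[R]_3) (s : R) : 'rV[R]_3 :=
  cross (tangent a s) (normal a s).

(* Since N and B do not vanish, [kappa] and [tau] are determined on [I] by
   the equations; their values outside [I] are irrelevant. *)
Definition frenet_spacelike (R : realType) (I : set R) (a : R -> 'rV[R]_3)
    (kappa tau : R -> R) : Prop :=
  forall s, I s ->
    [/\ (tangent a)^`() s = kappa s *: normal a s,
        (normal a)^`() s = - kappa s *: tangent a s + tau s *: binormal a s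
      & (binormal a)^`() s = tau s *: normal a s].

Definition frenet_timelike (R : realType) (I : set R) (a : R -> 'rV[R]_3)
    (kappa tau : R -> R) : Prop :=
  forall s, I s ->
    [/\ (tangent a)^`() s = kappa s *: normal a s,
        (normal a)^`() s = kappa s *: tangent a s + tau s *: binormal a s
      & (binormal a)^`() s = tau s *: normal a s].

Definition null_binormal (R : realType) (I : set R) (a B : R -> 'rV[R]_3) : Prop :=
  forall s, I s ->
    [/\ lightlike (B s), mink (tangent a s) (B s) = 0
      & mink (normal a s) (B s) = 1].

Definition frenet_lightlike (R : realType) (I : set R) (a B : R -> 'rV[R]_3)
    (tau : R -> R) : Prop :=
  forall s, I s ->
    [/\ (tangent a)^`() s = normal a s,
        (normal a)^`() s = tau s *: normal a s
      & B^`() s = - tangent a s - tau s *: B s].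

Definition constant_on (R : realType) (I : set R) (f : R -> R) : Prop :=
  exists c : R, forall s, I s -> f s = c.

Definition slant_helix (R : realType) (I : set R) (a : R -> 'rV[R]_3) : Prop :=
  exists U : 'rV[R]_3, U <> 0 /\ constant_on I (fun s => mink (normal a s) U).

(* Main.v *)
Require Import Defs.
From HB Require Import structures.
From mathcomp Require Import all_boot all_order all_algebra.
From mathcomp Require Import ring lra.
From mathcomp Require Import all_classical all_reals all_analysis.

Set Implicit Arguments.
Unset Strict Implicit.
Unset Printing Implicit Defensive.

Import Order.TTheory GRing.Theory Num.Theory.
Import numFieldNormedType.Exports.
Local Open Scope ring_scope.
Local Open Scope classical_set_scope.

(* For a nondegenerate frame write e = <N, N>, so that <B, B> = - e and
   N' = - e kappa T + tau B.  For a fixed vector U put f = <T, U>, c = <N, U>,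
   g = <B, U>.  If c is constant then f' = c kappa, e kappa f = tau g and
   g' = c tau, hence m = f^2 - e g^2 is constant and
   kappa^2 m = g^2 (tau^2 - e kappa^2).  A zero of g would force m = 0, then
   f = g = c = 0 and U = 0; so g and m do not vanish, tau / kappa = e f / g is
   differentiable, and the invariant equals - c d sgn(g) / sqrt |m|, where d is
   the sign of m and of tau^2 - e kappa^2.
   Conversely, with D = d (tau^2 - e kappa^2) and K the constant value of the
   invariant, the vector
   U = (e tau / sqrt D) T - e d K N - e (kappa / sqrt D) B has zero derivative.
   In the lightlike case N' = tau N, so N keeps a fixed lightlike direction U,
   and <N, U> = 0. *)

(** * Coordinates, the Minkowski product and the vector product *)

Lemma ord3_ind (P : 'I_3 -> Prop) :
  P 0 -> P 1 -> P 2%:R -> forall j, P j.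
Proof.
move=> P0 P1 P2 [[|[|[|//]]] j3].
- by rewrite (_ : Ordinal j3 = 0) //; apply: val_inj.
- by rewrite (_ : Ordinal j3 = 1) //; apply: val_inj.
- by rewrite (_ : Ordinal j3 = 2%:R) //; apply: val_inj.
Qed.

Lemma row3P (R : realType) (u v : 'rV[R]_3) :
  u 0 0 = v 0 0 -> u 0 1 = v 0 1 -> u 0 2%:R = v 0 2%:R -> u = v.
Proof.
move=> E0 E1 E2; apply/matrixP => i j; rewrite (ord1 i).
by move: j; apply: ord3_ind.
Qed.

Lemma cross_coord (R : realType) (u v : 'rV[R]_3) :
  [/\ cross u v 0 0 = u 0 1 * v 0 2%:R - u 0 2%:R * v 0 1,
      cross u v 0 1 = u 0 2%:R * v 0 0 - u 0 0 * v 0 2%:R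
    & cross u v 0 2%:R = u 0 1 * v 0 0 - u 0 0 * v 0 1].
Proof.
(* Reading entries through the underlying natural number identifies the ordinals produced by
   cofactor expansion with the numerals 0, 1, 2, so that [ring] sees equal atoms. *)
have [f entryE] : exists f : 'rV[R]_3 -> nat -> R,
    forall (p : 'rV[R]_3) j, p 0 j = f p (val j).
  by exists (fun p k => p 0 (inord k)) => p j; rewrite inord_val.
have detE (x y z : 'rV[R]_3) : det3 x y z =
    x 0 0 * (y 0 1 * z 0 2%:R - y 0 2%:R * z 0 1)
  - x 0 1 * (y 0 0 * z 0 2%:R - y 0 2%:R * z 0 0)
  + x 0 2%:R * (y 0 0 * z 0 1 - y 0 1 * z 0 0).
  rewrite /det3 (expand_det_row _ 0) !big_ord_recl big_ord0 /cofactor.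
  rewrite !(expand_det_row _ 0) !big_ord_recl !big_ord0 /cofactor !det_mx11.
  rewrite !mxE /= !entryE /= /bump /=.
  by ring.
by split; rewrite !mxE !detE !mxE /=; ring.
Qed.

Lemma minkC (R : realType) (u v : 'rV[R]_3) : mink u v = mink v u.
Proof. by rewrite /mink; ring. Qed.

Lemma minkDl (R : realType) (u v w : 'rV[R]_3) :
  mink (u + v) w = mink u w + mink v w.
Proof. by rewrite /mink !mxE; ring. Qed.

Lemma minkZl (R : realType) (c : R) (u w : 'rV[R]_3) :
  mink (c *: u) w = c * mink u w.
Proof. by rewrite /mink !mxE; ring. Qed.

Lemma mink0v (R : realType) (w : 'rV[R]_3) : mink 0 w = 0.
Proof. by rewrite -(scale0r w) minkZl mul0r. Qed.

Lemma mink_cross_l (R : realType) (u v : 'rV[R]_3) : mink u (cross u v) = 0.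
Proof. by rewrite /mink; have [-> -> ->] := cross_coord u v; ring. Qed.

Lemma mink_cross_r (R : realType) (u v : 'rV[R]_3) : mink v (cross u v) = 0.
Proof. by rewrite /mink; have [-> -> ->] := cross_coord u v; ring. Qed.

(** Lorentzian Lagrange identity, with the sign opposite to the Euclidean one; it is the source of
    <B, B> = - e. *)
Lemma mink_cross_cross (R : realType) (u v : 'rV[R]_3) :
  mink (cross u v) (cross u v) = mink u v ^+ 2 - mink u u * mink v v.
Proof. by rewrite /mink; have [-> -> ->] := cross_coord u v; ring. Qed.

(** In dimension three, det(u, v, w) x expands along the vector products of the pairs from u, v, w,
    with coefficients the products of x with the third vector. Taking w to be the vector product of
    u and v makes the determinant <w, w>. *)
Lemma mink_nondegenerate (R : realType) (u v x : 'rV[R]_3) :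
  mink (cross u v) (cross u v) != 0 ->
  mink u x = 0 -> mink v x = 0 -> mink (cross u v) x = 0 -> x = 0.
Proof.
move=> bb ux vx bx.
have expand (w : 'rV[R]_3) : mink (cross u v) w *: x =
    mink w x *: cross u v + mink u x *: cross v w + mink v x *: cross w u.
  have [uv0 uv1 uv2] := cross_coord u v.
  have [vw0 vw1 vw2] := cross_coord v w.
  have [wu0 wu1 wu2] := cross_coord w u.
  (* Generalizing keeps [mxE] from unfolding the vector products into determinants. *)
  move: (cross u v) (cross v w) (cross w u) uv0 uv1 uv2 vw0 vw1 vw2 wu0 wu1 wu2.
  move=> uv vw wu uv0 uv1 uv2 vw0 vw1 vw2 wu0 wu1 wu2.
  by apply: row3P; rewrite !mxE /mink uv0 uv1 uv2
    ?(vw0, vw1, vw2, wu0, wu1, wu2); ring.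
have /eqP := expand (cross u v).
by rewrite ux vx bx !scale0r !addr0 scaler_eq0 (negPf bb) => /eqP.
Qed.

(** * Differentiation rules for vector functions, quotients and square roots *)

Lemma is_derive_rowP (R : realType) (s : R) (u : R -> 'rV[R]_3) (du : 'rV[R]_3) :
  is_derive s 1 u du <->
  forall j, is_derive s 1 (fun t => u t 0 j) (du 0 j).
Proof.
split=> [[du_ex du_val] j|du_j].
  split; first exact: (derivable_mxP _ _ _).1.
  by rewrite -du_val derive_mx // mxE.
have ex : derivable u s 1.
  by apply/derivable_mxP => i j; rewrite (ord1 i); exact: ex_derive.
split=> //; rewrite derive_mx //; apply/matrixP => i j.
by rewrite mxE (ord1 i); exact: derive_val.
Qed.

Lemma is_derive_mulfun (R : realType) (s : R) (f g : R -> R) (df dg : R) :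
  is_derive s 1 f df -> is_derive s 1 g dg ->
  is_derive s 1 (fun t => f t * g t) (df * g s + f s * dg).
Proof.
move=> fP gP; apply: (@is_derive_eq _ _ _ (f * g)).
by rewrite /GRing.scale /=; ring.
Qed.

Lemma is_derive_mink (R : realType) (s : R) (u v : R -> 'rV[R]_3)
    (du dv : 'rV[R]_3) :
  is_derive s 1 u du -> is_derive s 1 v dv ->
  is_derive s 1 (fun t => mink (u t) (v t)) (mink du (v s) + mink (u s) dv).
Proof.
move=> /is_derive_rowP uP /is_derive_rowP vP.
have P j := is_derive_mulfun (uP j) (vP j).
apply: (is_derive_eq (is_deriveB (is_deriveD (P 0) (P 1)) (P 2%:R))).
by rewrite /mink; ring.
Qed.

Lemma is_derive_scale (R : realType) (s : R) (f : R -> R) (u : R -> 'rV[R]_3)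
    (df : R) (du : 'rV[R]_3) :
  is_derive s 1 f df -> is_derive s 1 u du ->
  is_derive s 1 (fun t => f t *: u t) (df *: u s + f s *: du).
Proof.
move=> fP /is_derive_rowP uP; apply/is_derive_rowP => j.
under eq_fun do rewrite mxE.
by rewrite !mxE; exact: is_derive_mulfun.
Qed.

Lemma is_derive_cross (R : realType) (s : R) (u v : R -> 'rV[R]_3)
    (du dv : 'rV[R]_3) :
  is_derive s 1 u du -> is_derive s 1 v dv ->
  is_derive s 1 (fun t => cross (u t) (v t)) (cross du (v s) + cross (u s) dv).
Proof.
move=> /is_derive_rowP uP /is_derive_rowP vP; apply/is_derive_rowP.
have P i j := is_derive_mulfun (uP i) (vP j).
have D i j k l := is_deriveB (P i j) (P k l).
have [du0 du1 du2] := cross_coord du (v s).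
have [dv0 dv1 dv2] := cross_coord (u s) dv.
apply: ord3_ind.
- have -> : (fun t => cross (u t) (v t) 0 0) =
      (fun t => u t 0 1 * v t 0 2%:R - u t 0 2%:R * v t 0 1).
    by apply/funext => t; have [-> _ _] := cross_coord (u t) (v t).
  by apply: (is_derive_eq (D 1 2%:R 2%:R 1)); rewrite mxE du0 dv0; ring.
- have -> : (fun t => cross (u t) (v t) 0 1) =
      (fun t => u t 0 2%:R * v t 0 0 - u t 0 0 * v t 0 2%:R).
    by apply/funext => t; have [_ -> _] := cross_coord (u t) (v t).
  by apply: (is_derive_eq (D 2%:R 0 0 2%:R)); rewrite mxE du1 dv1; ring.
- have -> : (fun t => cross (u t) (v t) 0 2%:R) =
      (fun t => u t 0 1 * v t 0 0 - u t 0 0 * v t 0 1).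
    by apply/funext => t; have [_ _ ->] := cross_coord (u t) (v t).
  by apply: (is_derive_eq (D 1 0 0 1)); rewrite mxE du2 dv2; ring.
Qed.

Lemma is_derive_divfun (R : realType) (s : R) (f g : R -> R) (df dg : R) :
  g s != 0 -> is_derive s 1 f df -> is_derive s 1 g dg ->
  is_derive s 1 (fun t => f t / g t) ((df * g s - f s * dg) / g s ^+ 2).
Proof.
move=> gs fP gP.
have gVP : is_derive s 1 (fun t => (g t)^-1) (- g s ^- 2 * dg).
  split; first by apply: derivableV => //; exact: ex_derive.
  by rewrite deriveV // derive_val.
by apply: (is_derive_eq (is_derive_mulfun fP gVP)); field.
Qed.

Lemma is_derive_sqrtfun (R : realType) (s : R) (f : R -> R) (df : R) :
  0 < f s -> is_derive s 1 f df ->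
  is_derive s 1 (fun t => Num.sqrt (f t)) (df / (2 * Num.sqrt (f s))).
Proof.
move=> fs fP.
apply: (is_derive_eq (is_derive1_comp (is_derive1_sqrt fs) fP)).
by rewrite /GRing.scale /=; ring.
Qed.

(** * Functions and derivatives on an interval *)

Lemma is_derive_0_constant (R : realType) (I : set R) (f : R -> R) :
  is_interval I -> (forall s, I s -> is_derive s 1 f 0) ->
  forall x y, I x -> I y -> f x = f y.
Proof.
move=> Iitv fP.
have H x y : x <= y -> I x -> I y -> f x = f y.
  move=> xy Ix Iy.
  have sub t : t \in `[x, y]%R -> I t.
    by rewrite in_itv /= => txy; exact: (Iitv x y).
  have fin t : t \in `]x, y[%R -> is_derive t 1 f (cst 0 t).
    by move=> txy; apply: fP; apply: sub; exact: subset_itv_oo_cc txy.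
  have fc : {within `[x, y], continuous f}.
    by apply: derivable_within_continuous => t /sub /fP[].
  have [t _] := MVT_segment xy fin fc.
  by rewrite mul0r => /eqP; rewrite subr_eq0 => /eqP ->.
move=> x y Ix Iy; have [xy|/ltW yx] := leP x y; first exact: H.
by symmetry; exact: H.
Qed.

(** By the intermediate value theorem a change of sign would produce a zero. It serves to fix the
    sign of <B, U>. *)
Lemma sgr_constant (R : realType) (I : set R) (f : R -> R) :
  is_interval I -> (forall s, I s -> derivable f s 1) ->
  (forall s, I s -> f s != 0) ->
  forall x y, I x -> I y -> Num.sg (f x) = Num.sg (f y).
Proof.
move=> Iitv fd f0.
have H x y : x <= y -> I x -> I y -> Num.sg (f x) = Num.sg (f y).
  move=> xy Ix Iy.
  have sub t : t \in `[x, y]%R -> I t.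
    by rewrite in_itv /= => txy; exact: (Iitv x y).
  have fc : {within `[x, y], continuous f}.
    by apply: derivable_within_continuous => t /sub /fd.
  apply: contrapT => sgxy.
  have [t txy ft] : exists2 t, t \in `[x, y]%R & f t = 0.
    apply: IVT => //; rewrite ge_min le_max.
    move: sgxy; have [fx|fx] : f x < 0 \/ 0 < f x by apply/orP; rewrite -neq_lt f0.
    - have [fy|fy] : f y < 0 \/ 0 < f y by apply/orP; rewrite -neq_lt f0.
        by rewrite !ltr0_sg.
      by rewrite (ltW fx) (ltW fy) orbT.
    - have [fy|fy] : f y < 0 \/ 0 < f y by apply/orP; rewrite -neq_lt f0.
        by rewrite (ltW fx) (ltW fy) orbT.
      by rewrite !gtr0_sg.
  by have := f0 _ (sub _ txy); rewrite ft eqxx.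
move=> x y Ix Iy; have [xy|/ltW yx] := leP x y; first exact: H.
by symmetry; exact: H.
Qed.

Lemma is_derive_unique (R : realType) (V : normedModType R) (s : R)
    (f : R -> V) (df dg : V) :
  is_derive s 1 f df -> is_derive s 1 f dg -> df = dg.
Proof. by move=> [_ <-] [_ <-]. Qed.

(** Openness turns equality on [I] into equality near [s]. This lets identities valid only on [I] be
    differentiated although the functions are total. *)
Lemma is_derive_on (R : realType) (V : normedModType R) (I : set R) (s : R)
    (f g : R -> V) (df : V) :
  open I -> I s -> (forall t, I t -> f t = g t) ->
  is_derive s 1 f df -> is_derive s 1 g df.
Proof.
move=> Iopen Is fg; apply: near_eq_is_derive.
have : \forall t \near s, I t by exact: open_nbhs_nbhs.
by apply: filterS => t /fg.
Qed.

Lemma is_derive_derive1 (R : realType) (V : normedModType R) (s : R)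
    (f : R -> V) : derivable f s 1 -> is_derive s 1 f (f^`() s).
Proof. by rewrite derive1E => /derivableP. Qed.

Lemma derive1_val (R : realType) (V : normedModType R) (s : R)
    (f : R -> V) (df : V) : is_derive s 1 f df -> f^`() s = df.
Proof. by rewrite derive1E => -[]. Qed.

Lemma is_derive_cmul (R : realType) (s c : R) (f : R -> R) (df : R) :
  is_derive s 1 f df -> is_derive s 1 (fun t => c * f t) (c * df).
Proof.
move=> fP.
apply: (is_derive_eq (is_derive_mulfun (is_derive_cst c s 1) fP)).
by rewrite mul0r add0r.
Qed.

Lemma is_derive_minkl (R : realType) (s : R) (u : R -> 'rV[R]_3)
    (du U : 'rV[R]_3) :
  is_derive s 1 u du -> is_derive s 1 (fun t => mink (u t) U) (mink du U).
Proof.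
move=> uP; apply: (is_derive_eq (is_derive_mink uP (is_derive_cst U s 1))).
by rewrite (minkC _ 0) mink0v addr0.
Qed.

(** Trades the real power for a square root, after which the invariant is a rational expression that
    [field] can handle. *)
Lemma powR_3_2 (R : realType) (x : R) : 0 < x -> x `^ (3 / 2) = x * Num.sqrt x.
Proof.
move=> x0; have -> : 3 / 2 = 1 + 2^-1 :> R by field.
by rewrite powRD ?(gt_eqF x0) ?implybT// powRr1 ?(ltW x0)// powR12_sqrt ?(ltW x0).
Qed.

Lemma sqrtr_sqrM (R : realType) (x y : R) :
  Num.sqrt (x ^+ 2 * y) = `|x| * Num.sqrt y.
Proof. by rewrite sqrtrM ?sqr_ge0 // sqrtr_sqr. Qed.

(** * Nondegenerate frames: the slant condition against constancy of the invariant *)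

Lemma row3_exists_neq0 (R : realType) : exists U : 'rV[R]_3, U <> 0.
Proof.
exists (const_mx 1) => /matrixP /(_ 0 0); rewrite !mxE.
by apply/eqP; rewrite oner_eq0.
Qed.

(* Common form of the two nondegenerate Frenet frames, with [e = <N, N>]. *)
Definition frenet_frame (R : realType) (I : set R) (e : R)
    (T N B : R -> 'rV[R]_3) (kappa tau : R -> R) : Prop :=
  forall s, I s ->
    [/\ is_derive s 1 T (kappa s *: N s),
        is_derive s 1 N (- (e * kappa s) *: T s + tau s *: B s)
      & is_derive s 1 B (tau s *: N s)] /\
    [/\ mink (T s) (T s) = 1, mink (T s) (N s) = 0, mink (N s) (N s) = e,
        B s = cross (T s) (N s) & 0 < kappa s].

(** The sign [d] is there to make the base of the power positive: [e = 1] with [d = 1] or [d = -1]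
    gives the two functions of the spacelike case, [e = -1] with [d = 1] that of the timelike
    case. *)
Definition slant_invariant (R : realType) (e d : R) (kappa tau : R -> R) (s : R) :
    R :=
  kappa s ^+ 2 / ((d * (tau s ^+ 2 - e * kappa s ^+ 2)) `^ (3 / 2)) *
  derive1 (fun t => tau t / kappa t) s.

Lemma frame_mink_binormal (R : realType) (I : set R) (e : R)
    (T N B : R -> 'rV[R]_3) (kappa tau : R -> R) (s : R) :
  frenet_frame I e T N B kappa tau -> I s -> mink (B s) (B s) = - e.
Proof.
move=> F /F [_ [TT TN NN -> _]].
by rewrite mink_cross_cross TT TN NN; ring.
Qed.

Lemma slant_invariant_constant (R : realType) (I : set R) (e : R)
    (T N B : R -> 'rV[R]_3) (kappa tau : R -> R) (U : 'rV[R]_3) (c : R) :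
  open I -> is_interval I -> e ^+ 2 = 1 -> frenet_frame I e T N B kappa tau ->
  (forall s, I s -> tau s != 0) ->
  (forall s, I s -> tau s ^+ 2 - e * kappa s ^+ 2 != 0) ->
  U <> 0 -> (forall s, I s -> mink (N s) U = c) ->
  exists d : R, [/\ d = 1 \/ d = -1,
    forall s, I s -> 0 < d * (tau s ^+ 2 - e * kappa s ^+ 2)
    & constant_on I (slant_invariant e d kappa tau)].
Proof.
move=> Iopen Iitv e2 F tau0 disc0 U0 NU.
(* The interval may be empty, whereas the constants below are values at a base point [s0]. *)
have [[s0 Is0]|Iempty] := pselect (exists s, I s); last first.
  by exists 1; split=> [|s Is|]; [left | case: Iempty; exists s
    | exists 0 => s Is; case: Iempty; exists s].
pose f t := mink (T t) U; pose g t := mink (B t) U.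
have fP s : I s -> is_derive s 1 f (kappa s * c).
  move=> Is; have [[dT _ _] _] := F s Is.
  by apply: (is_derive_eq (is_derive_minkl U dT)); rewrite minkZl NU.
have gP s : I s -> is_derive s 1 g (tau s * c).
  move=> Is; have [[_ _ dB] _] := F s Is.
  by apply: (is_derive_eq (is_derive_minkl U dB)); rewrite minkZl NU.
have fg s : I s -> e * kappa s * f s = tau s * g s.
  move=> Is; have [[_ dN _] _] := F s Is.
  have cP : is_derive s 1 (fun t => mink (N t) U) 0.
    apply: (is_derive_on Iopen Is) (is_derive_cst c s 1) => t It.
    by rewrite NU.
  have := is_derive_unique (is_derive_minkl U dN) cP.
  by rewrite minkDl !minkZl -/(f s) -/(g s) => ?; lra.
have kappa_gt0 s : I s -> 0 < kappa s by move=> /F [_ []].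
have kappa0 s : I s -> kappa s != 0 by move=> /kappa_gt0; case: ltgtP.
have kf s : I s -> kappa s * f s = e * (tau s * g s).
  by move=> Is; rewrite -fg // !mulrA -expr2 e2 mul1r.
(* Expanding U in the frame gives <U, U> = f^2 + e c^2 - e g^2, so m is <U, U> - e c^2; its
   constancy is checked by differentiation. *)
pose m t := f t * f t - e * (g t * g t).
have m_cst s : I s -> m s = m s0.
  move=> Is; apply: (is_derive_0_constant Iitv) => // t It.
  have ff := is_derive_mulfun (fP t It) (fP t It).
  have gg := is_derive_cmul e (is_derive_mulfun (gP t It) (gP t It)).
  apply: (is_derive_eq (is_deriveB ff gg)).
  transitivity (2 * c * (kappa t * f t - e * (tau t * g t))); first by ring.
  by rewrite kf // subrr mulr0.
have mE s : I s -> kappa s ^+ 2 * m s0 =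
    g s ^+ 2 * (tau s ^+ 2 - e * kappa s ^+ 2).
  move=> Is; rewrite -(m_cst s Is) /m.
  transitivity ((kappa s * f s) ^+ 2 - e * (kappa s * g s) ^+ 2); first by ring.
  by rewrite kf // exprMn e2; ring.
(* One zero of g gives m = 0. As the discriminant has no zero, [mE] then makes g vanish on all of
   [I], so g' = c tau yields c = 0 and all three frame products of U are zero. *)
have g0 s : I s -> g s != 0.
  move=> Is; apply/eqP => gs.
  have m0 : m s0 = 0.
    have /eqP := mE s Is; rewrite gs expr0n mul0r mulf_eq0 expf_eq0 /=.
    by rewrite (negPf (kappa0 s Is)) => /eqP.
  have g_eq0 t : I t -> g t = 0.
    move=> It; have /esym/eqP := mE t It; rewrite m0 mulr0 mulf_eq0.
    by rewrite (negPf (disc0 t It)) orbF expf_eq0 /= => /eqP.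
  have gd : is_derive s 1 g 0.
    apply: (is_derive_on Iopen Is) (is_derive_cst 0 s 1) => t It.
    by rewrite g_eq0.
  have /eqP := is_derive_unique (gP s Is) gd.
  rewrite mulf_eq0 (negPf (tau0 s Is)) /= => /eqP c0.
  have /eqP := kf s Is; rewrite gs !mulr0 mulf_eq0 (negPf (kappa0 s Is)) /=.
  move=> /eqP fs.
  have BB := frame_mink_binormal F Is.
  have [_ [_ _ _ BE _]] := F s Is.
  apply: U0; apply: (@mink_nondegenerate _ (T s) (N s)).
  - rewrite -BE BB oppr_eq0; apply/eqP => e0.
    by have /eqP := e2; rewrite e0 expr0n eq_sym oner_eq0.
  - exact: fs.
  - by rewrite NU.
  - by rewrite -BE; exact: gs.
have m_neq0 : m s0 != 0.
  apply/eqP => m0; have /esym/eqP := mE s0 Is0.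
  rewrite m0 mulr0 mulf_eq0 expf_eq0 /=.
  by rewrite (negPf (g0 s0 Is0)) (negPf (disc0 s0 Is0)).
(* By [mE], whose squared factors are positive, the discriminant has this sign at every point of
   [I]. *)
pose d := Num.sg (m s0).
have dpm : d = 1 \/ d = -1.
  by rewrite /d; case: sgrP m_neq0 => //; [left | right].
have dd : d * d = 1 by case: dpm => ->; ring.
have dm : `|m s0| = d * m s0 by rewrite normrEsg.
have absmE s : I s -> kappa s ^+ 2 * `|m s0| =
    g s ^+ 2 * (d * (tau s ^+ 2 - e * kappa s ^+ 2)).
  by move=> Is; rewrite dm mulrCA mE //; ring.
have D0 s : I s -> 0 < d * (tau s ^+ 2 - e * kappa s ^+ 2).
  move=> Is; have g2 : 0 < g s ^+ 2 by rewrite exprn_even_gt0 ?g0.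
  rewrite -(pmulr_rgt0 _ g2) -absmE //.
  by rewrite mulr_gt0 ?normr_gt0 // exprn_gt0 ?kappa_gt0.
exists d; split=> //.
(* With D = d (tau^2 - e kappa^2) the invariant comes out as - c d kappa / (g sqrt D), and [root]
   below turns kappa / (g sqrt D) into sgn(g) / sqrt |m|. *)
exists (- (c * d * Num.sg (g s0)) / Num.sqrt `|m s0|) => s Is.
(* [kappa] and [tau] are arbitrary functions here; the derivative is that of e f / g, which agrees
   with their quotient on [I] by [kf]. *)
have rP : is_derive s 1 (fun t => tau t / kappa t)
    (e * ((kappa s * c * g s - f s * (tau s * c)) / g s ^+ 2)).
  have := is_derive_cmul e (is_derive_divfun (g0 s Is) (fP s Is) (gP s Is)).
  apply: (is_derive_on Iopen Is) => t It.
  have kt := kappa0 t It; have gt := g0 t It.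
  rewrite -[f t](mulKf kt) kf //.
   transitivity (e ^+ 2 * (tau t / kappa t)); first by field; apply/andP.
  by rewrite e2 mul1r.
rewrite /slant_invariant (derive1_val rP) powR_3_2 ?D0 //.
have gd t : I t -> derivable g t 1 by move=> /gP[].
rewrite -(sgr_constant Iitv gd g0 Is Is0).
set D := d * _; have Dgt0 : 0 < D by exact: D0.
have sD0 : Num.sqrt D != 0 by rewrite sqrtr_eq0 -ltNge.
have sm0 : Num.sqrt `|m s0| != 0 by rewrite sqrtr_eq0 -ltNge normr_gt0.
have root : kappa s * Num.sqrt `|m s0| = Num.sg (g s) * g s * Num.sqrt D.
  have := congr1 Num.sqrt (absmE s Is).
  rewrite !sqrtr_sqrM (gtr0_norm (kappa_gt0 s Is)).
  by rewrite [`|g s|]normrEsg.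
have ks := kappa0 s Is; have gs := g0 s Is.
have -> : e * ((kappa s * c * g s - f s * (tau s * c)) / g s ^+ 2) =
    - (c * d * D) / (g s * kappa s).
  rewrite /D; have -> : f s = e * (tau s * g s) / kappa s.
    by rewrite -kf // mulrC mulKf.
  have -> : c * d * (d * (tau s ^+ 2 - e * kappa s ^+ 2)) =
      c * (e ^+ 2 * tau s ^+ 2 - e * kappa s ^+ 2).
    transitivity (d * d * (c * (tau s ^+ 2 - e * kappa s ^+ 2))); first by ring.
    by rewrite dd e2; ring.
  by field; apply/andP.
(* Solving [root] for the sign leaves a purely rational identity. *)
have -> : Num.sg (g s) = kappa s * Num.sqrt `|m s0| / (g s * Num.sqrt D).
  by rewrite root; field; apply/andP.
have Dn0 : D != 0 by rewrite gt_eqF.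
by field; rewrite ks gs sD0 sm0 Dn0.
Qed.

(** The vector comes from running the other direction backwards with |m| = 1 and g > 0: there g =
    kappa / sqrt D, f = e tau / sqrt D, c = - d K, and U = f T + e c N - e g B. *)
Lemma constant_slant (R : realType) (I : set R) (e d K : R)
    (T N B : R -> 'rV[R]_3) (kappa tau : R -> R) :
  is_interval I -> e ^+ 2 = 1 -> d ^+ 2 = 1 ->
  frenet_frame I e T N B kappa tau ->
  (forall s, I s -> derivable (fun t => tau t / kappa t) s 1) ->
  (forall s, I s -> 0 < d * (tau s ^+ 2 - e * kappa s ^+ 2)) ->
  (forall s, I s -> slant_invariant e d kappa tau s = K) ->
  exists U : 'rV[R]_3, U <> 0 /\ constant_on I (fun s => mink (N s) U).
Proof.
move=> Iitv e2 d2 F rd D0 invE.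
have [[s0 Is0]|Iempty] := pselect (exists s, I s); last first.
  have [U U0] := row3_exists_neq0 R; exists U; split=> //.
  by exists 0 => s Is; case: Iempty; exists s.
have kappa_gt0 s : I s -> 0 < kappa s by move=> /F [_ []].
have kappa0 s : I s -> kappa s != 0 by move=> /kappa_gt0; case: ltgtP.
(* Only the quotient r is known to be differentiable, so the coefficients are written through it:
   with q = sqrt D / kappa, tau / sqrt D is r / q and kappa / sqrt D is 1 / q. *)
pose r t := tau t / kappa t; pose G t := d * (r t * r t - e).
have DE s : I s -> d * (tau s ^+ 2 - e * kappa s ^+ 2) = kappa s ^+ 2 * G s.
  by move=> /kappa0 ?; rewrite /G /r; field.
have G0 s : I s -> 0 < G s.
  move=> Is; have := D0 s Is; rewrite DE // pmulr_rgt0 //.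
  by rewrite exprn_gt0 ?kappa_gt0.
pose q t := Num.sqrt (G t).
have q0 s : I s -> q s != 0 by move=> Is; rewrite sqrtr_eq0 -ltNge G0.
have q2 s : I s -> q s ^+ 2 = G s by move=> Is; rewrite sqr_sqrtr // ltW ?G0.
(* This is the constancy hypothesis solved for r', since D sqrt D = kappa^3 q^3. *)
have rP s : I s -> is_derive s 1 r (K * kappa s * q s ^+ 3).
  move=> Is; apply: (is_derive_eq (is_derive_derive1 (rd s Is))).
  have ks := kappa0 s Is; have qs := q0 s Is.
  rewrite -(invE s Is) /slant_invariant powR_3_2 ?D0 // DE //.
  rewrite sqrtr_sqrM (gtr0_norm (kappa_gt0 s Is)) -/(q s) -q2 //.
  by field; apply/andP.
have qP s : I s -> is_derive s 1 q (d * r s * K * kappa s * q s ^+ 2).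
  move=> Is; have qs := q0 s Is.
  have GP : is_derive s 1 G (2 * (d * (r s * (K * kappa s * q s ^+ 3)))).
    have rr := is_derive_mulfun (rP s Is) (rP s Is).
    have := is_derive_cmul d (is_deriveB rr (is_derive_cst e s 1)).
    by move=> /is_derive_eq; apply; ring.
  apply: (is_derive_eq (is_derive_sqrtfun (G0 s Is) GP)).
  by rewrite -/(q s); field.
have gP s : I s -> is_derive s 1 (fun t => 1 / q t) (- (d * K * tau s)).
  move=> Is; have ks := kappa0 s Is; have qs := q0 s Is.
  have oneP : is_derive s 1 (fun=> 1 : R) 0 by exact: is_derive_cst.
  apply: (is_derive_eq (is_derive_divfun qs oneP (qP s Is))).
  by rewrite /r; field; apply/andP.
have fP s : I s -> is_derive s 1 (fun t => e * r t / q t) (- (d * K * kappa s)).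
  move=> Is; have qs := q0 s Is.
  have := is_derive_divfun qs (is_derive_cmul e (rP s Is)) (qP s Is).
  move=> /is_derive_eq; apply.
  transitivity (e * K * kappa s * (q s ^+ 2 - d * (r s * r s))); first by field.
  rewrite q2 // /G; transitivity (- (e ^+ 2 * d * K * kappa s)); first by ring.
  by rewrite e2 mul1r.
(* In U' the constant coefficient of N cancels the T and B components coming from [fP] and [gP],
   while the N component cancels because r kappa = tau. *)
pose U t := ((e * r t / q t) *: T t + (- (e * d * K)) *: N t) +
  (- e * (1 / q t)) *: B t.
have UP s : I s -> is_derive s 1 U 0.
  move=> Is; have [[dT dN dB] _] := F s Is.
  have ks := kappa0 s Is; have qs := q0 s Is.
  have PT := is_derive_scale (fP s Is) dT.
  have PN := is_derive_scale (is_derive_cst (- (e * d * K)) s 1) dN.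
  have PB := is_derive_scale (is_derive_cmul (- e) (gP s Is)) dB.
  apply: (is_derive_eq (is_deriveD (is_deriveD PT PN) PB)).
  apply/rowP => j; rewrite !mxE /= /r.
  set x := T s 0 j; set y := N s 0 j; set z := B s 0 j.
  transitivity ((e ^+ 2 - 1) * d * K * kappa s * x); last by rewrite e2 subrr !mul0r.
  by field; apply/andP.
have Ucst s : I s -> U s = U s0.
  move=> Is; apply/rowP => j.
  apply: (@is_derive_0_constant R I (fun t => U t 0 j)) => // t It.
  have /is_derive_rowP /(_ j) := UP t It.
  by move=> /is_derive_eq; apply; rewrite mxE.
exists (U s0); split.
  (* Nonvanishing is read off from <B, U> = 1 / q. *)
  move=> U0; have /eqP : mink (B s0) (U s0) = 0 by rewrite U0 minkC mink0v.
  have BB := frame_mink_binormal F Is0.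
  have [_ [_ _ _ BE _]] := F s0 Is0.
  rewrite minkC /U !minkDl !minkZl BB BE mink_cross_l mink_cross_r.
  have -> : e * r s0 / q s0 * 0 + - (e * d * K) * 0 + - e * (1 / q s0) * - e =
    e ^+ 2 / q s0 by ring.
  by rewrite e2 mul1r invr_eq0 (negPf (q0 s0 Is0)).
exists (- (d * K)) => s Is; rewrite -(Ucst s Is).
have [_ [_ TN NN BE _]] := F s Is.
rewrite minkC /U !minkDl !minkZl TN NN BE (minkC (cross _ _)) mink_cross_r.
transitivity (- (e ^+ 2 * d * K)); first by ring.
by rewrite e2 mul1r.
Qed.

(** * From a unit speed curve to a nondegenerate frame *)

(** Division by the norm leaves only a sign, and the unscaled branch fits because the sign of 0 is
    0. Hence N and a'' have the same causal character when a'' is nonzero. *)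
Lemma mink_normal (R : realType) (a : R -> 'rV[R]_3) (s : R) :
  mink (normal a s) (normal a s) = Num.sg (mink (derive1n 2 a s) (derive1n 2 a s)).
Proof.
rewrite /normal /mink_norm; case: eqP => [->|/eqP q0]; first by rewrite sgr0.
rewrite minkZl minkC minkZl mulrA -expr2 exprVn sqr_sqrtr //.
by rewrite {2}[mink _ _]numEsg mulrCA mulVf ?mulr1 // normr_eq0.
Qed.

Lemma normal_neq0 (R : realType) (a : R -> 'rV[R]_3) (s : R) :
  derive1n 2 a s <> 0 -> normal a s <> 0.
Proof.
move=> a2; rewrite /normal /mink_norm; case: eqP => [_ //|/eqP q0] /eqP.
rewrite scaler_eq0 invr_eq0 => /orP[|/eqP //].
by rewrite gt_eqF // sqrtr_gt0 normr_gt0.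
Qed.

Lemma smooth_derivable (R : realType) (I : set R) (a : R -> 'rV[R]_3) (n : nat)
    (s : R) : smooth_on I a -> I s ->
  is_derive s 1 (derive1n n a) (derive1n n.+1 a s).
Proof. by move=> sm Is; apply: is_derive_derive1; exact: sm. Qed.

Lemma unit_speed_mink (R : realType) (I : set R) (a : R -> 'rV[R]_3) (s : R) :
  spacelike_curve I a -> unit_speed I a -> I s ->
  mink (tangent a s) (tangent a s) = 1.
Proof.
move=> [[_ reg] sp] us Is.
have [TT|T0] := sp s Is; last by case: (reg s Is).
have := us s Is; rewrite /mink_norm (gtr0_norm TT) => sq.
by rewrite -[LHS](sqr_sqrtr (ltW TT)) sq expr1n.
Qed.

(** The Frenet equations only prescribe values of derivatives. Differentiability of N, B and tau /
    kappa is recovered from smoothness of the curve, by writing each through derivatives of a. *)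
Lemma frenet_frame_normal (R : realType) (I : set R) (a : R -> 'rV[R]_3)
    (e : R) (kappa tau : R -> R) :
  open I -> spacelike_curve I a -> unit_speed I a ->
  e ^+ 2 = 1 ->
  (forall s, I s -> mink (normal a s) (normal a s) = e) ->
  (forall s, I s ->
    [/\ (tangent a)^`() s = kappa s *: normal a s,
        (normal a)^`() s = - (e * kappa s) *: tangent a s + tau s *: binormal a s
      & (binormal a)^`() s = tau s *: normal a s]) ->
  frenet_frame I e (tangent a) (normal a) (binormal a) kappa tau /\
  forall s, I s -> derivable (fun t => tau t / kappa t) s 1.
Proof.
move=> Iopen sp us e2 NN frenet.
have sm : smooth_on I a by case: sp => -[].
have e0 : e != 0.
  by apply/eqP => e0; have /eqP := e2; rewrite e0 expr0n eq_sym oner_eq0.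
(* On [I] this equals |<a'', a''>|, in a form without absolute value that can be differentiated. *)
pose w t := e * mink (derive1n 2 a t) (derive1n 2 a t).
have sgw s : I s -> Num.sg (mink (derive1n 2 a s) (derive1n 2 a s)) = e.
  by move=> Is; rewrite -mink_normal NN.
have wE s : I s -> w s = `|mink (derive1n 2 a s) (derive1n 2 a s)|.
  by move=> Is; rewrite normrEsg sgw.
have w0 s : I s -> 0 < w s.
  by move=> Is; rewrite wE // normr_gt0 -sgr_eq0 sgw.
have sw0 s : I s -> Num.sqrt (w s) != 0 by move=> Is; rewrite sqrtr_eq0 -ltNge w0.
have NE s : I s -> (1 / Num.sqrt (w s)) *: derive1n 2 a s = normal a s.
  move=> Is; rewrite /normal /mink_norm -wE // div1r ifN //.
  by rewrite -sgr_eq0 sgw.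
have aE s : I s -> derive1n 2 a s = kappa s *: normal a s by move=> /frenet[].
have kappaE s : I s -> Num.sqrt (w s) = kappa s.
  move=> Is; apply: (mulIf e0).
  rewrite -{2}(NN s Is) -minkZl -aE // -(NN s Is) -minkZl -NE // scalerA.
  by rewrite mulrCA mulfV ?sw0 // mulr1 scale1r.
have kappa_gt0 s : I s -> 0 < kappa s by move=> Is; rewrite -kappaE // sqrtr_gt0 w0.
have dT s : I s -> is_derive s 1 (tangent a) (kappa s *: normal a s).
  move=> Is; rewrite -(aE s Is).
  by have := smooth_derivable 1 sm Is; rewrite derive1n1.
have dsw s : I s -> exists dk, is_derive s 1 (fun t => Num.sqrt (w t)) dk.
  move=> Is; have d2 := smooth_derivable 2 sm Is.
  eexists; exact: is_derive_sqrtfun (w0 s Is)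
    (is_derive_cmul e (is_derive_mink d2 d2)).
have dN s : I s -> is_derive s 1 (normal a)
    (- (e * kappa s) *: tangent a s + tau s *: binormal a s).
  move=> Is; have [_ <- _] := frenet s Is; apply: is_derive_derive1.
  have [dk dkP] := dsw s Is.
  have oneP : is_derive s 1 (fun=> 1 : R) 0 by exact: is_derive_cst.
  have swVP := is_derive_divfun (g := fun t => Num.sqrt (w t))
    (sw0 s Is) oneP dkP.
  have P := is_derive_scale swVP (smooth_derivable 2 sm Is).
  by case: (is_derive_on Iopen Is NE P).
have dB s : I s -> is_derive s 1 (binormal a) (tau s *: normal a s).
  move=> Is; have [_ _ <-] := frenet s Is; apply: is_derive_derive1.
  by have [] := is_derive_cross (dT s Is) (dN s Is).
(* Differentiating <T, T> = 1 gives 2 kappa <T, N> = 0. *)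
have TN s : I s -> mink (tangent a s) (normal a s) = 0.
  move=> Is; have oneP : is_derive s 1 (fun t => mink (tangent a t) (tangent a t)) 0.
    apply: (is_derive_on Iopen Is) (is_derive_cst (1 : R) s 1) => t It.
    by rewrite (unit_speed_mink sp us It).
  have := is_derive_unique (is_derive_mink (dT s Is) (dT s Is)) oneP.
  rewrite (minkC _ (kappa s *: _)) minkZl minkC -mulr2n => /eqP.
  by rewrite mulrn_eq0 mulf_eq0 (gt_eqF (kappa_gt0 s Is)) => /eqP.
have F : frenet_frame I e (tangent a) (normal a) (binormal a) kappa tau.
  move=> s Is; split; first by split; [exact: dT | exact: dN | exact: dB].
  by split; [exact: unit_speed_mink us Is | exact: TN | exact: NN | |
    exact: kappa_gt0].
split=> // s Is.
(* From a''' = kappa' N + kappa N' one gets <a''', B> = kappa tau <B, B> = - e kappa tau, and w =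
   kappa^2. The left side is visibly differentiable. *)
have tauE t : I t -> - e * (mink (derive1n 3 a t) (binormal a t)) / (w t) =
    tau t / kappa t.
  move=> It; have [dk dkP] := dsw t It.
  have dP := is_derive_scale dkP (dN t It).
  have kNE x : I x -> Num.sqrt (w x) *: normal a x = derive1n 2 a x.
    by move=> Ix; rewrite aE // kappaE.
  rewrite -(is_derive_unique (is_derive_on Iopen It kNE dP)
    (smooth_derivable 2 sm It)).
  have BB := frame_mink_binormal F It.
  have [_ [_ _ _ BE _]] := F t It.
  rewrite minkDl !minkZl minkDl !minkZl BB BE mink_cross_l mink_cross_r.
  have wk : w t = kappa t ^+ 2 by rewrite -kappaE // sqr_sqrtr // ltW ?w0.
  have k0 : kappa t != 0 by rewrite gt_eqF ?kappa_gt0.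
  rewrite (kappaE t It) wk.
  transitivity (e ^+ 2 * (tau t / kappa t)); first by field.
  by rewrite e2 mul1r.
have d2 := smooth_derivable 2 sm Is.
have wP := is_derive_cmul e (is_derive_mink d2 d2).
have ws : w s != 0 by rewrite gt_eqF ?w0.
have hP := is_derive_cmul (- e) (is_derive_mink
  (smooth_derivable 3 sm Is) (dB s Is)).
by case: (is_derive_on Iopen Is tauE (is_derive_divfun ws hP wP)).
Qed.

Lemma slant_helix_iff (R : realType) (I : set R) (e : R) (a : R -> 'rV[R]_3)
    (kappa tau : R -> R) :
  open I -> is_interval I -> spacelike_curve I a -> unit_speed I a ->
  e ^+ 2 = 1 ->
  (forall s, I s -> mink (normal a s) (normal a s) = e) ->
  (forall s, I s ->
    [/\ (tangent a)^`() s = kappa s *: normal a s,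
        (normal a)^`() s = - (e * kappa s) *: tangent a s + tau s *: binormal a s
      & (binormal a)^`() s = tau s *: normal a s]) ->
  (forall s, I s -> tau s <> 0) ->
  (forall s, I s -> tau s ^+ 2 - e * kappa s ^+ 2 <> 0) ->
  slant_helix I a <->
  exists d : R, [/\ d = 1 \/ d = -1,
    forall s, I s -> 0 < d * (tau s ^+ 2 - e * kappa s ^+ 2)
    & constant_on I (slant_invariant e d kappa tau)].
Proof.
move=> Iopen Iitv sp us e2 NN frenet tau0 disc0.
have [F rd] := frenet_frame_normal Iopen sp us e2 NN frenet.
split=> [[U [U0 [c NU]]]|[d [dpm D0 [K invK]]]].
  apply: (slant_invariant_constant Iopen Iitv e2 F _ _ U0 NU) => s Is; apply/eqP.
    exact: tau0.
  exact: disc0.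
apply: (constant_slant Iitv e2 _ F rd D0 invK).
by case: dpm => ->; ring.
Qed.

(** * Lightlike normals *)

Lemma slant_helix_lightlike (R : realType) (I : set R) (a : R -> 'rV[R]_3)
    (tau : R -> R) :
  open I -> is_interval I -> smooth_on I a ->
  (forall s, I s -> lightlike (normal a s)) ->
  (forall s, I s -> (normal a)^`() s = tau s *: normal a s) ->
  slant_helix I a.
Proof.
move=> Iopen Iitv sm light dN.
have [[s0 Is0]|Iempty] := pselect (exists s, I s); last first.
  have [U U0] := row3_exists_neq0 R; exists U; split=> //.
  by exists 0 => s Is; case: Iempty; exists s.
have NE s : I s -> derive1n 2 a s = normal a s.
  move=> Is; have [/eqP + _] := light s Is.
  by rewrite mink_normal sgr_eq0 /normal => ->.
have NP s : I s -> is_derive s 1 (normal a) (tau s *: normal a s).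
  move=> Is; rewrite -(dN s Is); apply: is_derive_derive1.
  by case: (is_derive_on Iopen Is NE (smooth_derivable 2 sm Is)).
(* If the timelike coordinate of a lightlike vector vanished, the other two would have squares
   summing to zero. *)
have N2 s : I s -> normal a s 0 2%:R != 0.
  move=> Is; apply/eqP => N2; have [NN N0] := light s Is; apply: N0.
  move: NN; rewrite /mink N2 mulr0 subr0 -!expr2 => /eqP.
  rewrite paddr_eq0 ?sqr_ge0 // !expf_eq0 /= => /andP[/eqP N0 /eqP N1].
  by apply: row3P; rewrite !mxE.
(* Under N' = tau N all coordinates have the same logarithmic derivative, so these ratios are
   constant; this gives the fixed direction without integrating tau. *)
pose ratio s j := normal a s 0 j / normal a s 0 2%:R.
have ratio_cst s j : I s -> ratio s j = ratio s0 j.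
  move=> Is; apply: (@is_derive_0_constant R I (fun t => ratio t j)) => // t It.
  have /is_derive_rowP P := NP t It.
  apply: (is_derive_eq (is_derive_divfun (N2 t It) (P j) (P 2%:R))).
  by rewrite !mxE; have := N2 t It => ?; field.
have NU s : I s -> normal a s =
    (normal a s 0 2%:R / normal a s0 0 2%:R) *: normal a s0.
  move=> Is; apply/rowP => j; rewrite mxE.
  transitivity (normal a s 0 2%:R * ratio s j).
    by rewrite /ratio mulrC divfK // N2.
  by rewrite (ratio_cst s j Is) /ratio -[RHS]mulrA [in RHS](mulrC _^-1).
have [NN N0] := light s0 Is0.
exists (normal a s0); split=> //.
by exists 0 => s Is; rewrite NU // minkZl NN mulr0.
Qed.

(** * The three causal characters of the normal *)

Theorem theorem1p3 (R : realType) (I : set R) (a : R -> 'rV[R]_3)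
    (Iopen : open I) (Iitv : is_interval I)
    (acurve : spacelike_curve I a) (aunit : unit_speed I a)
    (a2_neq0 : forall s, I s -> (a^`(2)) s <> 0) :
  (forall kappa tau : R -> R,
     (forall s, I s -> spacelike (normal a s)) ->
     frenet_spacelike I a kappa tau ->
     (forall s, I s -> kappa s <> 0) ->
     (forall s, I s -> tau s <> 0) ->
     (forall s, I s -> tau s ^+ 2 - kappa s ^+ 2 <> 0) ->
     (slant_helix I a <->
      ((forall s, I s -> kappa s ^+ 2 < tau s ^+ 2) /\
       constant_on I (fun s =>
         kappa s ^+ 2 / ((tau s ^+ 2 - kappa s ^+ 2) `^ (3 / 2)) *
         derive1 (fun t => tau t / kappa t) s)) \/
      ((forall s, I s -> tau s ^+ 2 < kappa s ^+ 2) /\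
       constant_on I (fun s =>
         kappa s ^+ 2 / ((kappa s ^+ 2 - tau s ^+ 2) `^ (3 / 2)) *
         derive1 (fun t => tau t / kappa t) s)))) /\
  (forall kappa tau : R -> R,
     (forall s, I s -> timelike (normal a s)) ->
     frenet_timelike I a kappa tau ->
     (forall s, I s -> kappa s <> 0) ->
     (forall s, I s -> tau s <> 0) ->
     (slant_helix I a <->
      constant_on I (fun s =>
        kappa s ^+ 2 / ((tau s ^+ 2 + kappa s ^+ 2) `^ (3 / 2)) *
        derive1 (fun t => tau t / kappa t) s))) /\
  (forall (B : R -> 'rV[R]_3) (tau : R -> R),
     (forall s, I s -> lightlike (normal a s)) ->
     null_binormal I a B ->
     frenet_lightlike I a B tau ->
     (forall s, I s -> tau s <> 0) ->
     slant_helix I a).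
Proof.
split=> [kappa tau Nsp frenet _ tau0 disc0|].
  have NN s : I s -> mink (normal a s) (normal a s) = 1.
    (* [spacelike] admits the zero vector, which is excluded because a'' does not vanish. *)
    move=> Is; have [|N0] := Nsp s Is; last by case: (normal_neq0 (a2_neq0 s Is)).
    by rewrite mink_normal sgr_gt0 => /gtr0_sg.
  have frenet1 s : I s ->
    [/\ (tangent a)^`() s = kappa s *: normal a s,
        (normal a)^`() s = - (1 * kappa s) *: tangent a s + tau s *: binormal a s
      & (binormal a)^`() s = tau s *: normal a s].
    by move=> /frenet; rewrite mul1r.
  have disc1 s : I s -> tau s ^+ 2 - 1 * kappa s ^+ 2 <> 0.
    by rewrite mul1r; exact: disc0.
  rewrite (slant_helix_iff Iopen Iitv acurve aunit (expr1n _ 2)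
    NN frenet1 tau0 disc1).
  have invP : slant_invariant 1 1 kappa tau = (fun s =>
      kappa s ^+ 2 / ((tau s ^+ 2 - kappa s ^+ 2) `^ (3 / 2)) *
      derive1 (fun t => tau t / kappa t) s).
    by apply/funext => s; rewrite /slant_invariant !mul1r.
  have invN : slant_invariant 1 (-1) kappa tau = (fun s =>
      kappa s ^+ 2 / ((kappa s ^+ 2 - tau s ^+ 2) `^ (3 / 2)) *
      derive1 (fun t => tau t / kappa t) s).
    by apply/funext => s; rewrite /slant_invariant mul1r mulN1r opprB.
  split=> [[d [[->|->] D0]]|[[D0]|[D0]]].
  - rewrite invP => ?; left; split=> // s Is.
    by have := D0 s Is; rewrite !mul1r subr_gt0.
  - rewrite invN => ?; right; split=> // s Is.
    by have := D0 s Is; rewrite mul1r mulN1r opprB subr_gt0.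
  - rewrite -invP => ?; exists 1; split=> // [|s Is]; first by left.
    by rewrite !mul1r subr_gt0 D0.
  - rewrite -invN => ?; exists (-1); split=> // [|s Is]; first by right.
    by rewrite mul1r mulN1r opprB subr_gt0 D0.
split=> [kappa tau Ntl frenet kappa0 tau0|B tau light _ frenet _]; last first.
  apply: (slant_helix_lightlike (tau := tau) Iopen Iitv _ light).
    by case: acurve => -[].
  by move=> s /frenet[].
have NN s : I s -> mink (normal a s) (normal a s) = -1.
  by move=> /Ntl; rewrite /timelike mink_normal sgr_lt0 => /ltr0_sg.
have frenetN s : I s ->
  [/\ (tangent a)^`() s = kappa s *: normal a s,
      (normal a)^`() s = - (-1 * kappa s) *: tangent a s + tau s *: binormal a s
    & (binormal a)^`() s = tau s *: normal a s].
  by move=> /frenet; rewrite mulN1r opprK.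
have disc_gt0 s : I s -> 0 < tau s ^+ 2 - -1 * kappa s ^+ 2.
  move=> Is; rewrite mulN1r opprK addr_gt0 // exprn_even_gt0 //=; apply/eqP.
    exact: tau0.
  exact: kappa0.
have discN s : I s -> tau s ^+ 2 - -1 * kappa s ^+ 2 <> 0.
  by move=> /disc_gt0 D0 DE; rewrite DE ltxx in D0.
have e2 : (-1 : R) ^+ 2 = 1 by rewrite sqrrN expr1n.
rewrite (slant_helix_iff Iopen Iitv acurve aunit e2 NN frenetN tau0 discN).
have invP : slant_invariant (-1) 1 kappa tau = (fun s =>
    kappa s ^+ 2 / ((tau s ^+ 2 + kappa s ^+ 2) `^ (3 / 2)) *
    derive1 (fun t => tau t / kappa t) s).
  by apply/funext => s; rewrite /slant_invariant mul1r mulN1r opprK.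
rewrite -invP; split=> [[d [[->|->] D0]] // |inv].
  (* For [d = -1] the two sign conditions contradict each other at any point, so [I] is empty and
     any constant will do. *)
  move=> _; exists 0 => s Is; have := D0 s Is; have := disc_gt0 s Is.
  by rewrite (mulN1r (_ - _)) oppr_gt0 => /lt_trans H /H; rewrite ltxx.
exists 1; split=> // [|s Is]; first by left.
by rewrite mul1r; exact: disc_gt0.
Qed.
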